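(* Let $\Psi=\forall x\,\gamma(x)\wedge\forall x\forall y\,(x\neq y\to\alpha(x,y))\wedge\bigwedge_{i=1}^m\forall x\exists y\,(\beta_i(x,y)\wedge x\neq y)$ be a sentence over the vocabulary $\{U_1,\ldots,U_n,\beta_1,\ldots,\beta_k\}$ as described in the context, and let $\Psi^*$ be the equality-free sentence constructed from $\Psi$ in the context. If $\Psi^*$ is satisfiable, then $\Psi$ is satisfiable.
   Context: In $\Psi$: $U_1,\ldots,U_n$ are unary and $\beta_1,\ldots,\beta_k$ are binary predicates, $k\ge m\ge 1$; $\gamma,\alpha$ are quantifier-free and equality-free; there are no constants, and no atoms $R(x,x)$ or $R(y,y)$ with $R$ binary occur. $\Psi^*$ is over the vocabulary with binary predicates $\beta_1,\ldots,\beta_k$ and unary predicates $K_s,K_t,S_1,\ldots,S_n,T_1,\ldots,T_n,P_1,\ldots,P_k,\overline P_1,\ldots,\overline P_k,Z_1,\ldots,Z_p$ with $p=n+\lceil\log_2(3m)\rceil$. Abbreviations: - $\xi_S(x,y):=\bigwedge_{i=1}^n(S_i(x)\leftrightarrow S_i(y))$; $\xi_T(x,y):=\bigwedge_{i=1}^n(T_i(x)\leftrightarrow T_i(y))$; $\xi_Z(x,y):=\bigwedge_{i=1}^p(Z_i(x)\leftrightarrow Z_i(y))$; - $\xi_P(x,y):=\bigwedge_{i=1}^k(P_i(x)\leftrightarrow P_i(y))\wedge(\overline P_i(x)\leftrightarrow\overline P_i(y))$; - $\xi_{\mathrm{rev}}(x,y):=\bigwedge_{i=1}^k(P_i(x)\leftrightarrow\overline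 P_i(y))\wedge(\overline P_i(x)\leftrightarrow P_i(y))$; - $\xi_{S,T}(x,y):=\bigwedge_{i=1}^n(S_i(x)\leftrightarrow T_i(y))$; - $\xi_{\neq}(x,y):=(K_s(x)\wedge K_s(y))\to\neg\xi_S(x,y)$; - $\xi_{\mathrm{id}}(x,y):=\xi_S(x,y)\wedge\bigl((\neg K_s(y)\wedge K_t(y))\to\xi_Z(x,y)\bigr)$. $\Psi^*:=\bigwedge_{i=1}^{10}\psi_i$, where - $\psi_1:=\forall x\,\bigvee_{i=1}^m(P_i(x)\vee\overline P_i(x))$; - $\psi_2:=\forall x\forall y\,\xi_S(x,y)\to(K_s(x)\leftrightarrow K_s(y))$; - $\psi_3:=\forall x\forall y\,\xi_T(x,y)\to(K_t(x)\leftrightarrow K_t(y))$; - $\psi_4:=\forall x\exists y\,\bigl(\xi_{S,T}(x,y)\wedge\xi_{S,T}(y,x)\wedge\xi_{\mathrm{rev}}(x,y)\wedge(K_s(x)\leftrightarrow K_t(y))\wedge(K_t(x)\leftrightarrow K_s(y))\bigr)$; - $\psi_5:=\forall x\,\xi_{S,T}(x,x)\to(\neg K_s(x)\wedge\neg K_t(x))$; - $\psi_6:=\forall x\forall y\,\bigl(\xi_S(x,y)\wedge\xi_T(x,y)\wedge\xi_Z(x,y)\wedge K_t(x)\bigr)\to\xi_P(x,y)$; - $\psi_7:=\forall x\,K_s(x)\to\bigwedge_{i=1}^p\neg Z_i(x)$; - $\psi_8:=\forall x\,\gamma_1(x)$, where $\gamma_1$ is $\gamma$ with each $U_i(x)$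 replaced by $S_i(x)$; - $\psi_9:=\forall x\,\alpha_1(x)\wedge\forall x\forall y\,(\xi_{\neq}(x,y)\to\alpha_2(x,y))$, where $\alpha_1(x)$ is obtained from $\alpha(x,y)$ by replacing each $U_i(x)$ with $S_i(x)$, each $U_i(y)$ with $T_i(x)$, each $\beta_i(x,y)$ with $P_i(x)$ and each $\beta_i(y,x)$ with $\overline P_i(x)$; and $\alpha_2(x,y)$ is obtained from $\alpha(x,y)$ by replacing each $U_i(x)$ with $S_i(x)$ and each $U_i(y)$ with $S_i(y)$, leaving binary atoms unchanged; - $\psi_{10}:=\bigwedge_{i=1}^m\forall x\exists y\,(\xi_{\mathrm{id}}(x,y)\wedge P_i(y))$. *)

(* Defs.v *)
From mathcomp Require Import all_boot.

Set Implicit Arguments.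
Unset Strict Implicit.
Unset Printing Implicit Defensive.

(* First-order logic with equality, in the two variables x and y, over a      *)
(* vocabulary of unary predicates [un] and binary predicates [bn] (and no     *)
(* constants or function symbols).                                            *)

Variant var := vx | vy.

Definition eqv (v w : var) : bool :=
  match v, w with vx, vx | vy, vy => true | _, _ => false end.

Inductive formula (un bn : Type) : Type :=
| Tru
| Fls
| Un of un & var
| Bin of bn & var & var
| Equ of var & var
| Not of formula un bn
| And of formula un bn & formula un bn
| Or of formula un bn & formula un bn
| Imp of formula un bn & formula un bn
| Iff of formula un bn & formula un bn
| All of var & formula un bn
| Ex of var & formula un bn.

Arguments Tru {un bn}.
Arguments Fls {un bn}.
Arguments Un {un bn} _ _.
Arguments Bin {un bn} _ _ _.
Arguments Equ {un bn} _ _.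
Arguments And {un bn} _ _.
Arguments Or {un bn} _ _.

Declare Scope fo_scope.
Delimit Scope fo_scope with fo.
Bind Scope fo_scope with formula.

Notation "¬ f" := (Not f) (at level 75, right associativity) : fo_scope.
Infix "∧" := And (at level 80, right associativity) : fo_scope.
Infix "∨" := Or (at level 85, right associativity) : fo_scope.
Infix "→" := Imp (at level 99, right associativity) : fo_scope.
Infix "↔" := Iff (at level 95, no associativity) : fo_scope.
Notation "v ≉ w" := (Not (Equ v w)) (at level 70, no associativity) : fo_scope.
Notation "∀ v , f" := (All v f) (at level 200, v at level 0, right associativity)
  : fo_scope.
Notation "∃ v , f" := (Ex v f) (at level 200, v at level 0, right associativity)
  : fo_scope.
Notation "⋀_ ( i < n ) f" := (\big[And/Tru]_(i < n) f%fo)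
  (at level 41, i, n at level 50, f at level 41) : fo_scope.
Notation "⋁_ ( i < n ) f" := (\big[Or/Fls]_(i < n) f%fo)
  (at level 41, i, n at level 50, f at level 41) : fo_scope.

Record structure (un bn : Type) := Structure {
  dom : Type;
  dom_inhabited : inhabited dom;
  interp_un : un -> dom -> Prop;
  interp_bin : bn -> dom -> dom -> Prop }.

Arguments interp_un {un bn} _ _ _.
Arguments interp_bin {un bn} _ _ _ _.

Definition upd (D : Type) (e : var -> D) (v : var) (d : D) : var -> D :=
  fun w => if eqv w v then d else e w.

Fixpoint holds un bn (M : structure un bn) (e : var -> dom M)
    (f : formula un bn) : Prop :=
  match f with
  | Tru => True
  | Fls => False
  | Un u v => interp_un M u (e v)
  | Bin b v w => interp_bin M b (e v) (e w)
  | Equ v w => e v = e w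
  | Not g => ~ holds e g
  | And g h => holds e g /\ holds e h
  | Or g h => holds e g \/ holds e h
  | Imp g h => holds e g -> holds e h
  | Iff g h => holds e g <-> holds e h
  | All v g => forall d : dom M, holds (upd e v d) g
  | Ex v g => exists d : dom M, holds (upd e v d) g
  end.

Definition satisfiable un bn (f : formula un bn) : Prop :=
  exists M : structure un bn, forall e : var -> dom M, holds e f.

Fixpoint quantifier_free un bn (f : formula un bn) : bool :=
  match f with
  | Tru | Fls | Un _ _ | Bin _ _ _ | Equ _ _ => true
  | Not g => quantifier_free g
  | And g h | Or g h | Imp g h | Iff g h =>
      quantifier_free g && quantifier_free h
  | All _ _ | Ex _ _ => false
  end.

Fixpoint equality_free un bn (f : formula un bn) : bool :=
  match f with
  | Tru | Fls | Un _ _ | Bin _ _ _ => true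
  | Equ _ _ => false
  | Not g | All _ g | Ex _ g => equality_free g
  | And g h | Or g h | Imp g h | Iff g h => equality_free g && equality_free h
  end.

(* No atom R(x,x) or R(y,y) with R a binary predicate. *)
Fixpoint diagonal_free un bn (f : formula un bn) : bool :=
  match f with
  | Tru | Fls | Un _ _ | Equ _ _ => true
  | Bin _ v w => ~~ eqv v w
  | Not g | All _ g | Ex _ g => diagonal_free g
  | And g h | Or g h | Imp g h | Iff g h => diagonal_free g && diagonal_free h
  end.

Fixpoint free_in un bn (z : var) (f : formula un bn) : bool :=
  match f with
  | Tru | Fls => false
  | Un _ v => eqv z v
  | Bin _ v w | Equ v w => eqv z v || eqv z w
  | Not g => free_in z g
  | And g h | Or g h | Imp g h | Iff g h => free_in z g || free_in z h
  | All v g | Ex v g => ~~ eqv z v && free_in z g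
  end.

Fixpoint replace_atoms un bn un' bn' (fu : un -> var -> formula un' bn')
    (fb : bn -> var -> var -> formula un' bn') (f : formula un bn)
    : formula un' bn' :=
  let r := replace_atoms fu fb in
  match f with
  | Tru => Tru
  | Fls => Fls
  | Un u v => fu u v
  | Bin b v w => fb b v w
  | Equ v w => Equ v w
  | Not g => Not (r g)
  | And g h => And (r g) (r h)
  | Or g h => Or (r g) (r h)
  | Imp g h => Imp (r g) (r h)
  | Iff g h => Iff (r g) (r h)
  | All v g => All v (r g)
  | Ex v g => Ex v (r g)
  end.

(* U_i is [i : 'I_n] and beta_i is [i : 'I_k], with indices starting at 0.    *)
Definition source_formula (n k : nat) := formula 'I_n 'I_k.

Definition Psi (n k m : nat) (mk : m <= k) (gamma alpha : source_formula n k)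
    : source_formula n k :=
  ((∀ vx, gamma)
   ∧ (∀ vx, ∀ vy, vx ≉ vy → alpha)
   ∧ ⋀_(i < m) (∀ vx, ∃ vy, Bin (widen_ord mk i) vx vy ∧ vx ≉ vy))%fo.

(* [up_log 2 a] is the ceiling of the base-2 logarithm of a, for a > 0. *)
Definition nZ (n m : nat) : nat := n + up_log 2 (3 * m).

Variant star_unary (n k m : nat) : Type :=
| uKs
| uKt
| uS of 'I_n
| uT of 'I_n
| uP of 'I_k
| uPbar of 'I_k
| uZ of 'I_(nZ n m).

Arguments uKs {n k m}.
Arguments uKt {n k m}.
Arguments uS {n k m} _.
Arguments uT {n k m} _.
Arguments uP {n k m} _.
Arguments uPbar {n k m} _.
Arguments uZ {n k m} _.

Definition star_formula (n k m : nat) := formula (star_unary n k m) 'I_k.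

Section Star.

Variables (n k m : nat).
Local Notation form := (star_formula n k m).
Local Open Scope fo_scope.

Definition Ks (v : var) : form := Un uKs v.
Definition Kt (v : var) : form := Un uKt v.
Definition S_ (i : 'I_n) (v : var) : form := Un (uS i) v.
Definition T_ (i : 'I_n) (v : var) : form := Un (uT i) v.
Definition P_ (i : 'I_k) (v : var) : form := Un (uP i) v.
Definition Pbar_ (i : 'I_k) (v : var) : form := Un (uPbar i) v.
Definition Z_ (i : 'I_(nZ n m)) (v : var) : form := Un (uZ i) v.

Definition xi_S (v w : var) : form := ⋀_(i < n) (S_ i v ↔ S_ i w).
Definition xi_T (v w : var) : form := ⋀_(i < n) (T_ i v ↔ T_ i w).
Definition xi_Z (v w : var) : form := ⋀_(i < nZ n m) (Z_ i v ↔ Z_ i w).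
Definition xi_P (v w : var) : form :=
  ⋀_(i < k) ((P_ i v ↔ P_ i w) ∧ (Pbar_ i v ↔ Pbar_ i w)).
Definition xi_rev (v w : var) : form :=
  ⋀_(i < k) ((P_ i v ↔ Pbar_ i w) ∧ (Pbar_ i v ↔ P_ i w)).
Definition xi_ST (v w : var) : form := ⋀_(i < n) (S_ i v ↔ T_ i w).
Definition xi_neq (v w : var) : form := (Ks v ∧ Ks w) → ¬ xi_S v w.
Definition xi_id (v w : var) : form :=
  xi_S v w ∧ ((¬ Ks w ∧ Kt w) → xi_Z v w).

(* Used both for gamma_1 and for alpha_2. *)
Definition replace_S (f : source_formula n k) : form :=
  replace_atoms S_ (fun i v w => Bin i v w) f.

(* Diagonal atoms, left unchanged here, do not occur in alpha. *)
Definition replace_ST (f : source_formula n k) : form :=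
  replace_atoms
    (fun i v => match v with vx => S_ i vx | vy => T_ i vx end)
    (fun i v w => match v, w with
                  | vx, vy => P_ i vx
                  | vy, vx => Pbar_ i vx
                  | _, _ => Bin i v w
                  end) f.

Variable mk : m <= k.

Definition psi1 : form :=
  ∀ vx, ⋁_(i < m) (P_ (widen_ord mk i) vx ∨ Pbar_ (widen_ord mk i) vx).
Definition psi2 : form := ∀ vx, ∀ vy, xi_S vx vy → (Ks vx ↔ Ks vy).
Definition psi3 : form := ∀ vx, ∀ vy, xi_T vx vy → (Kt vx ↔ Kt vy).
Definition psi4 : form :=
  ∀ vx, ∃ vy, xi_ST vx vy ∧ xi_ST vy vx ∧ xi_rev vx vy
              ∧ (Ks vx ↔ Kt vy) ∧ (Kt vx ↔ Ks vy).
Definition psi5 : form := ∀ vx, xi_ST vx vx → (¬ Ks vx ∧ ¬ Kt vx).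
Definition psi6 : form :=
  ∀ vx, ∀ vy, (xi_S vx vy ∧ xi_T vx vy ∧ xi_Z vx vy ∧ Kt vx) → xi_P vx vy.
Definition psi7 : form := ∀ vx, Ks vx → ⋀_(i < nZ n m) (¬ Z_ i vx).
Definition psi8 (gamma : source_formula n k) : form := ∀ vx, replace_S gamma.
Definition psi9 (alpha : source_formula n k) : form :=
  (∀ vx, replace_ST alpha) ∧ (∀ vx, ∀ vy, xi_neq vx vy → replace_S alpha).
Definition psi10 : form :=
  ⋀_(i < m) (∀ vx, ∃ vy, xi_id vx vy ∧ P_ (widen_ord mk i) vy).

Definition Psi_star (gamma alpha : source_formula n k) : form :=
  psi1 ∧ psi2 ∧ psi3 ∧ psi4 ∧ psi5 ∧ psi6 ∧ psi7
  ∧ psi8 gamma ∧ psi9 alpha ∧ psi10.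

End Star.

(* Main.v *)
Require Import Defs.
From mathcomp Require Import all_boot boolp.

(** Each element [y] of a model of [Psi_star] describes an ordered pair of
    elements of the model of [Psi] to be built: the predicates [S] and [T] give
    the unary types of its source and of its target, [P] and [Pbar] the binary
    atoms between the two, and [K_s], [K_t] mark source and target as kings.
    The model of [Psi] has one element for each king type and, above each
    non-king [x], one copy of [x] for every finite sequence of indices below [m].
    The copy of [x] at [c] gets its [i]-th witness either from a king, in which
    case the pair is determined by [S], [T] and [Z], or from an element at
    [i :: c].  Since these sequences form a tree, no pair of non-kings is
    described in two ways; pairs that no [y] describes inherit the binary
    relations of the model of [Psi_star]. *)

Set Implicit Arguments.
Unset Strict Implicit.
Unset Printing Implicit Defensive.

(** * Evaluation of translated formulas *)

Lemma holds_bigAnd un bn (M : structure un bn) (e : var -> dom M) n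
    (F : 'I_n -> formula un bn) :
  holds e (\big[And/Tru]_(i < n) F i) <-> forall i, holds e (F i).
Proof.
elim: n F => [|n IHn] F; first by rewrite big_ord0; split=> // _ [].
rewrite big_ord_recl /= IHn; split=> [[F0 FS] i | F_].
  by case: (unliftP ord0 i) => [j|] ->.
by split=> [|i]; apply: F_.
Qed.

(** Atoms need to agree only on free variables, since [gamma] is compared under environments with
    unrelated values at [vy], and only off the diagonal, where both translations are faithful. *)
Lemma holds_replace_atoms un bn un' bn' (M : structure un' bn')
    (N : structure un bn) (e : var -> dom M) (e' : var -> dom N)
    (fu : un -> var -> formula un' bn') (fb : bn -> var -> var -> formula un' bn')
    (f : formula un bn) :
  quantifier_free f -> equality_free f -> diagonal_free f ->
  (forall u v, free_in v f -> holds e (fu u v) <-> interp_un N u (e' v)) ->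
  (forall b v w, ~~ eqv v w -> free_in v f -> free_in w f ->
     holds e (fb b v w) <-> interp_bin N b (e' v) (e' w)) ->
  holds e (replace_atoms fu fb f) <-> holds e' f.
Proof.
have eqvv v : eqv v v by case: v.
elim: f => [||u v|b v w|//|g IHg|g IHg h IHh|g IHg h IHh|g IHg h IHh|g IHg h IHh|//|//] //=.
- by move=> _ _ _ fuE _; apply: fuE.
- by move=> _ _ nvw _ fbE; apply: fbE => //; rewrite eqvv ?orbT.
- by move=> qf ef df fuE fbE; rewrite IHg.
all: move=> /andP[qg qh] /andP[eg eh] /andP[dg dh] fuE fbE.
all: have {}IHg := IHg qg eg dg (fun u v vg => fuE u v (introT orP (or_introl vg)))
  (fun b v w nvw vg wg =>
     fbE b v w nvw (introT orP (or_introl vg)) (introT orP (or_introl wg))).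
all: have {}IHh := IHh qh eh dh (fun u v vh => fuE u v (introT orP (or_intror vh)))
  (fun b v w nvw vh wh =>
     fbE b v w nvw (introT orP (or_intror vh)) (introT orP (or_intror wh))).
all: by rewrite IHg IHh.
Qed.

(** * The tree unfolding, with types as abstract data *)

Section Unfolding.

Variables (X Sig Zty : Type) (J : finType) (I : Type).
Variables (Ks Kt : X -> Prop) (sty tty : X -> Sig) (zty : X -> Zty).
Variables (pty pbty : X -> {ffun J -> bool}).
Variable atom : I -> J.

Hypothesis X_inh : inhabited X.
Hypothesis Ks_sty : forall x y, sty x = sty y -> Ks x -> Ks y.
Hypothesis rev_ex : forall x, exists y,
  [/\ sty x = tty y, sty y = tty x, pty x = pbty y /\ pbty x = pty y,
      Ks x <-> Kt y & Kt x <-> Ks y].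
Hypothesis loop_nonking : forall x, sty x = tty x -> ~ Kt x.
Hypothesis king_target : forall x y, sty x = sty y -> tty x = tty y ->
  zty x = zty y -> Kt x -> pty x = pty y /\ pbty x = pbty y.
Hypothesis king_zty : forall x y, Ks x -> Ks y -> zty x = zty y.
Hypothesis wit_ex : forall i x, exists y,
  [/\ sty x = sty y, ~ Ks y /\ Kt y -> zty x = zty y & pty y (atom i)].

Section Edges.

Variables (rep : Sig -> X) (rev : X -> X) (wit : I -> X -> X).
Hypothesis repP : forall x, sty (rep (sty x)) = sty x.
Hypothesis revP : forall x,
  [/\ sty x = tty (rev x), sty (rev x) = tty x,
      pty x = pbty (rev x) /\ pbty x = pty (rev x),
      Ks x <-> Kt (rev x) & Kt x <-> Ks (rev x)].
Hypothesis witP : forall i x,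
  [/\ sty x = sty (wit i x), ~ Ks (wit i x) /\ Kt (wit i x) -> zty x = zty (wit i x)
    & pty (wit i x) (atom i)].

(** Keeps a single copy of each king type. *)
Definition normal (d : X * seq I) : Prop := Ks d.1 -> d = (rep (sty d.1), [::]).

(** A pair ending in a king is fixed by the [Z]-type of its source; a pair of non-kings is described
    only from a node to a child created as its witness. A pair from a king to a non-king is read off
    the opposite edge. *)
Definition edge (d1 d2 : X * seq I) (y : X) : Prop :=
  [/\ sty y = sty d1.1, tty y = sty d2.1 &
      Ks d2.1 /\ zty y = zty d1.1 \/
      [/\ ~ Ks d1.1, ~ Ks d2.1 &
          exists i, y = wit i d1.1 /\ d2 = (rev y, i :: d1.2)]].

Lemma Kt_Ks x y : tty y = sty x -> Kt y <-> Ks x.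
Proof.
have [_ rE _ _ ->] := revP y; rewrite -rE => e.
by split; apply: Ks_sty.
Qed.

(** If [d2] is a king, [king_target] applies; otherwise the head of its sequence recovers the
    witness index. *)
Lemma edge_uniq d1 d2 y y' : edge d1 d2 y -> edge d1 d2 y' ->
  pty y = pty y' /\ pbty y = pbty y'.
Proof.
move=> [s1 t1 E] [s2 t2 E'].
case: E E' => [[K z]|[n1 n2 [i [-> e]]]] [[K' z']|[n1' n2' [j [-> e']]]] //.
- by apply: king_target; rewrite ?s1 ?t1 ?z //; apply/(Kt_Ks t1).
- by move: e'; rewrite e => -[_ ->].
Qed.

(** Two non-kings cannot be children of each other, by the lengths of their sequences. For two
    kings, [rev y] and [y'] have king sources, hence equal [Z]-types, and [king_target] identifies
    their binary types. *)
Lemma edge_rev d1 d2 y y' : edge d1 d2 y -> edge d2 d1 y' ->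
  pty y = pbty y' /\ pbty y = pty y'.
Proof.
move=> [s1 t1 E] [s2 t2 E'].
case: E E' => [[K z]|[n1 n2 [i [_ e]]]] [[K' z']|[n1' n2' [j [_ e']]]] //; last first.
  have /(congr1 size)/= := congr1 snd e.
  by rewrite e' /= => /eqP; rewrite -addn2 -{1}[size _]addn0 eqn_add2l.
have [rs rt [-> ->] rK rK'] := revP y.
have [] // := king_target (x := rev y) (y := y').
- by rewrite rt t1 s2.
- by rewrite -rs s1 t2.
- apply: king_zty; first by apply/rK'/(Kt_Ks t1).
  by apply: Ks_sty K.
- by apply/rK; apply: Ks_sty K'.
Qed.

Lemma edge_witness i d : normal d -> exists2 d', normal d' /\ d <> d' &
  exists y, edge d d' y /\ pty y (atom i) \/ edge d' d y /\ pbty y (atom i).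
Proof.
case: d => x c nx; set y := wit i x.
have [s z Py] : [/\ sty x = sty y, _ & pty y (atom i)] := witP i x.
have [rs rt [rp _] rK rK'] := revP y.
case: (pselect (Kt y)) => [Ky|nKy].
  (* The target is a king, so its unique copy must serve; were it [d] itself, [y] would be a loop
     with a king target. *)
  exists (rep (sty (rev y)), [::]).
    split; first by move=> /=; rewrite repP.
    by move=> [xE _]; apply: (@loop_nonking y) => //; rewrite -s xE repP.
  exists y; left; split=> //; split=> //=; first by rewrite repP.
  left; split; first by apply: Ks_sty (iffLR rK' Ky); rewrite repP.
  (* The witness condition fixes the [Z]-type only when [y] is not a king; otherwise [x] and [y] are
     both kings. *)
  case: (pselect (Ks y)) => Ksy; last by rewrite -z.
  by apply: king_zty => //; apply: Ks_sty Ksy.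
have nKr : ~ Ks (rev y) by move/rK'.
case: (pselect (Ks x)) => Kx.
  (* The edge runs backwards, into the king [x]; choosing [rev y] itself as source makes the
     [Z]-condition trivial. *)
  exists (rev y, [::]); first by split=> // -[xE _]; rewrite -xE in nKr.
  exists (rev y); right; split; last by rewrite -rp.
  by split=> //=; [rewrite -rs | left].
exists (rev y, i :: c).
  by split=> // -[_ /(congr1 size)/= /eqP]; rewrite -addn1 -{1}[size _]addn0 eqn_add2l.
exists y; left; split=> //; split=> //=; right; split=> //.
by exists i.
Qed.

Definition beta (R : J -> X -> X -> Prop) (j : J) (d1 d2 : X * seq I) : Prop :=
  [\/ exists2 y, edge d1 d2 y & pty y j,
      exists2 y, edge d2 d1 y & pbty y j |
      ~ (exists y, edge d1 d2 y \/ edge d2 d1 y) /\ R j d1.1 d2.1].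

Lemma betaE R d1 d2 y : edge d1 d2 y ->
  forall j, (beta R j d1 d2 <-> pty y j) /\ (beta R j d2 d1 <-> pbty y j).
Proof.
move=> E j; split; split.
- case=> [[y' E' ?]|[y' E' ?]|[[]]]; last by exists y; left.
    by have [-> _] := edge_uniq E E'.
  by have [-> _] := edge_rev E E'.
- by move=> ?; constructor 1; exists y.
- case=> [[y' E' ?]|[y' E' ?]|[[]]]; last by exists y; right.
    by have [_ ->] := edge_rev E E'.
  by have [_ ->] := edge_uniq E E'.
- by move=> ?; constructor 2; exists y.
Qed.

(** The alternatives match the two conjuncts of [psi9]: either some [y] describes the pair, or the
    guard [xi_neq] holds and the relations are inherited. *)
Lemma beta_pair R d1 d2 : normal d1 -> normal d2 -> d1 <> d2 ->
  (exists y, [/\ sty y = sty d1.1, tty y = sty d2.1 &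
     forall j, (beta R j d1 d2 <-> pty y j) /\ (beta R j d2 d1 <-> pbty y j)])
  \/ ~ [/\ Ks d1.1, Ks d2.1 & sty d1.1 = sty d2.1] /\
     forall j, (beta R j d1 d2 <-> R j d1.1 d2.1) /\
               (beta R j d2 d1 <-> R j d2.1 d1.1).
Proof.
move=> n1 n2 d12.
case: (pselect (exists y, edge d1 d2 y \/ edge d2 d1 y)) => [[y [E|E]]|nE].
- by left; exists y; have [? ? _] := E; split=> //; apply: betaE.
- left; exists (rev y); have [s t _] := E; have [rs rt [rp rpb] _ _] := revP y.
  split; [by rewrite rt | by rewrite -rs | move=> j].
  by rewrite -rp -rpb; have [] := betaE R E j.
right; split.
  by move=> [K1 K2 s12]; apply: d12; rewrite (n1 K1) (n2 K2) s12.
have nE' : ~ exists y, edge d2 d1 y \/ edge d1 d2 y.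
  by move=> [y [E|E]]; apply: nE; exists y; [right | left].
by move=> j; split; split=> [|?]; try (by constructor 3);
  case=> [[y E]|[y E]|[]] // _; [case: nE | case: nE | case: nE' | case: nE'];
  exists y; auto.
Qed.

End Edges.

Lemma unfolding (R : J -> X -> X -> Prop) :
  exists (D : Type) (proj : D -> X) (b : J -> D -> D -> Prop),
  [/\ inhabited D,
      forall d1 d2, d1 <> d2 ->
        (exists y, [/\ sty y = sty (proj d1), tty y = sty (proj d2) &
           forall j, (b j d1 d2 <-> pty y j) /\ (b j d2 d1 <-> pbty y j)])
        \/ ~ [/\ Ks (proj d1), Ks (proj d2) & sty (proj d1) = sty (proj d2)] /\
           forall j, (b j d1 d2 <-> R j (proj d1) (proj d2)) /\
                     (b j d2 d1 <-> R j (proj d2) (proj d1))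
    & forall i d, exists2 d', d <> d' & b (atom i) d d'].
Proof.
have [x0] := X_inh.
have [rev revP] := choice rev_ex.
pose wit i := projT1 (choice (wit_ex i)).
have witP i x := projT2 (choice (wit_ex i)) x.
(* Types that are not realised get the default [x0]. *)
have rep_ex s : exists y, (exists x, sty x = s) -> sty y = s.
  by case: (pselect (exists x, sty x = s)) => [[x xs]|ns]; [exists x | exists x0].
have [rep repE] := choice rep_ex.
have repP x : sty (rep (sty x)) = sty x by apply: repE; exists x.
(* Normality is made boolean so that elements of [D] are equal as soon as their underlying pairs
   are. *)
pose D := {d : X * seq I | `[< normal rep d >]}.
have normD (d : D) : normal rep (val d) by apply/asboolP; apply: valP d.
pose mkD d (nd : normal rep d) : D := Sub d (asboolT nd).
exists D, (fun d => (val d).1), (fun j d1 d2 => beta rev wit R j (val d1) (val d2)).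
split.
- have n0 : normal rep (rep (sty x0), [::]) by move=> _ /=; rewrite repP.
  exact: (inhabits (mkD _ n0)).
- move=> d1 d2 d12; apply: beta_pair => //; by move/val_inj.
- move=> i d; have [d' [nd' dd'] [y E]] := edge_witness repP revP witP i (normD d).
  exists (mkD d' nd'); first by move=> e; apply: dd'; rewrite e.
  by case: E => -[E ?]; [constructor 1 | constructor 2]; exists y.
Qed.

End Unfolding.

(** * Types in a model of [Psi_star], and the resulting model of [Psi] *)

Definition types un bn (M : structure un bn) (I : finType) (f : I -> un)
    (x : dom M) : {ffun I -> bool} :=
  [ffun i => `[< interp_un M (f i) x >]].

Lemma eq_types un bn (M : structure un bn) (I : finType) (f g : I -> un)
    (x y : dom M) :
  types f x = types g y <-> forall i, interp_un M (f i) x <-> interp_un M (g i) y.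
Proof.
split=> [/ffunP E i | E]; first by apply: asbool_eq_equiv; have := E i; rewrite !ffunE.
by apply/ffunP => i; rewrite !ffunE; apply: asbool_equiv_eq.
Qed.

(** Covers [xi_S], [xi_T], [xi_Z] and [xi_ST]. *)
Lemma holds_eq_types un bn (M : structure un bn) (e : var -> dom M) n
    (f g : 'I_n -> un) (v w : var) :
  holds e (\big[And/Tru]_(i < n) Iff (Un (f i) v) (Un (g i) w)) <->
  types f (e v) = types g (e w).
Proof. by rewrite holds_bigAnd eq_types. Qed.

Theorem lemma4p4 (n k m : nat) (m_gt0 : 1 <= m) (mk : m <= k)
    (gamma alpha : source_formula n k)
    (gamma_qf : quantifier_free gamma) (gamma_ef : equality_free gamma)
    (gamma_df : diagonal_free gamma) (gamma_x : ~~ free_in vy gamma)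
    (alpha_qf : quantifier_free alpha) (alpha_ef : equality_free alpha)
    (alpha_df : diagonal_free alpha) :
  satisfiable (Psi_star mk gamma alpha) -> satisfiable (Psi mk gamma alpha).
Proof.
case=> M sat; have [x0] := dom_inhabited M.
have {sat} := sat (fun=> x0).
case=> _ [psi2 [_ [psi4 [psi5 [psi6 [psi7 [psi8 [[psi9 psi9'] psi10]]]]]]]].
pose Ks : dom M -> Prop := interp_un M uKs.
pose Kt : dom M -> Prop := interp_un M uKt.
pose sty : dom M -> {ffun _} := types (@uS n k m).
pose tty : dom M -> {ffun _} := types (@uT n k m).
pose zty : dom M -> {ffun _} := types (@uZ n k m).
pose pty : dom M -> {ffun _} := types (@uP n k m).
pose pbty : dom M -> {ffun _} := types (@uPbar n k m).
have Ks_sty x y : sty x = sty y -> Ks x -> Ks y.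
  by move=> E; apply: (iffLR (psi2 x y _)); apply/holds_eq_types.
have rev_ex x : exists y, [/\ sty x = tty y, sty y = tty x,
    pty x = pbty y /\ pbty x = pty y, Ks x <-> Kt y & Kt x <-> Ks y].
  have [y [/holds_eq_types E1 [/holds_eq_types E2 [/holds_bigAnd E3 [E4 E5]]]]] := psi4 x.
  exists y; split=> //.
  by split; apply/eq_types => i; have [] := E3 i.
have loop_nonking x : sty x = tty x -> ~ Kt x.
  by move=> E; have [] // := psi5 x _; apply/holds_eq_types.
have king_target x y : sty x = sty y -> tty x = tty y -> zty x = zty y -> Kt x ->
    pty x = pty y /\ pbty x = pbty y.
  move=> Es Et Ez Kx; pose e := upd (upd (fun=> x0) vx x) vy y.
  have /holds_bigAnd E : holds e (xi_P n k m vx vy).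
    by apply: (psi6 x y); split; [|split; [|split]] => //; apply/holds_eq_types.
  by split; apply/eq_types => i; have [] := E i.
have king_zty x y : Ks x -> Ks y -> zty x = zty y.
  move=> /psi7/holds_bigAnd Zx /psi7/holds_bigAnd Zy.
  by apply/eq_types => i; split=> Zi; [case: (Zx i) | case: (Zy i)].
have wit_ex i x : exists y,
    [/\ sty x = sty y, ~ Ks y /\ Kt y -> zty x = zty y & pty y (widen_ord mk i)].
  have [y [[/holds_eq_types Es Ez] Py]] := iffLR (holds_bigAnd _ _) psi10 i x.
  exists y; split=> //; first by move=> /Ez/holds_eq_types.
  by rewrite ffunE; apply/asboolP.
have [D [proj [beta [D_inh pairs wits]]]] := unfolding (inhabits x0) Ks_sty rev_ex
  loop_nonking king_target king_zty wit_ex (interp_bin M).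
pose N := @Structure 'I_n 'I_k D D_inh (fun u d => interp_un M (uS u) (proj d)) beta.
exists N => e0; split; [|split].
- move=> d; have := psi8 (proj d).
  have fx v : free_in v gamma -> v = vx by case: v gamma_x => // /negbTE ->.
  apply: iffLR; apply: holds_replace_atoms => //.
    by move=> u v /fx ->.
  by move=> b v w nvw /fx Ev /fx Ew; rewrite Ev Ew in nvw.
- move=> d1 d2 d12.
  have [[y [/eq_types s /eq_types t E]]|[nK E]] := pairs _ _ d12.
    (* The single element [y] carries all atoms of the pair, so [alpha_1] at [y] is [alpha] at [d1],
       [d2]. *)
    have := psi9 y; apply: iffLR; apply: holds_replace_atoms => //.
      by move=> u [] _ /=; [exact: s | exact: t].
    move=> b v w; have [E1 E2] := E b.
    by case: v; case: w => //= _ _ _; rewrite ?E1 ?E2 ffunE; split=> /asboolP.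
  (* The projections may coincide here; [alpha_2] still applies because its guard only excludes
     kings of equal [S]-type. *)
  apply: iffLR (psi9' (proj d1) (proj d2) _).
    apply: holds_replace_atoms => //.
      by move=> u [] _.
    move=> b v w; have [E1 E2] := E b.
    by case: v; case: w => //= _ _ _; rewrite ?E1 ?E2.
  by move=> [K1 K2] /holds_eq_types sE; apply: nK.
- apply/holds_bigAnd => i d; have [d' dd' ?] := wits i d.
  by exists d'; split=> // /esym.
Qed.
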